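(* For every integer $n\geq 1$, \[ \mathrm{lcm}\big\{\mathrm{denom}(\mathrm{coeff}(w,H)) : w\in\{\mathtt{A},\mathtt{B}\}^n\big\} = n!\,d_n , \] i.e. $n!\,d_n$ is the smallest common denominator of the coefficients of all words of length $n$ in the Baker--Campbell--Hausdorff series $H$.
   Context: Let $\mathbb{Q}\langle\langle \mathtt{A},\mathtt{B}\rangle\rangle$ be the ring of formal power series in the non-commuting variables $\mathtt{A},\mathtt{B}$ with rational coefficients. The Baker--Campbell--Hausdorff series is \[ H=\log(e^{\mathtt{A}}e^{\mathtt{B}})=\sum_{k\geq 1}\frac{(-1)^{k+1}}{k}\Big(\sum_{i+j>0}\frac{1}{i!\,j!}\mathtt{A}^i\mathtt{B}^j\Big)^k . \] For a word $w$, $\mathrm{coeff}(w,H)$ denotes the coefficient of $w$ in $H$. $\{\mathtt{A},\mathtt{B}\}^n$ denotes the set of words of length $n$ over the alphabet $\{\mathtt{A},\mathtt{B}\}$. For $r\in\mathbb{Q}$, $\mathrm{denom}(r)$ is the smallest positive integer $d$ with $rd\in\mathbb{Z}$ (so $\mathrm{denom}(0)=1$), and $\mathrm{lcm}$ is the least common multiple of a finite set of integers. For a prime $p$ and $n\geq1$ with $p$-adic expansion $n=\alpha_0+\alpha_1p+\dots+\alpha_rp^r$, $0\le\alpha_i\le p-1$, let $s_p(n)=\alpha_0+\dots+\alpha_r$ and $l(n,p)=\max\{t : p^t\le s_p(n)\}=\lfloor \log_p s_p(n)\rfloor$. Define $d_n=\prod_{p \text{ prime},\, p<n} p^{l(n,p)}$.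 *)

(* Defs.v *)
From mathcomp Require Import all_boot all_order all_algebra.
Set Implicit Arguments.
Unset Strict Implicit.
Unset Printing Implicit Defensive.
Import Order.TTheory GRing.Theory Num.Theory.
Local Open Scope ring_scope.

(* A series is its coefficient function on words; [true] is the letter A and
   [false] the letter B. *)
Definition word := seq bool.
Definition ncseries := word -> rat.

Definition coeff (w : word) (f : ncseries) : rat := f w.

Definition nc1 : ncseries := fun w => (w == [::])%:R.
Definition ncvar (a : bool) : ncseries := fun w => (w == [:: a])%:R.
Definition ncA : ncseries := ncvar true.
Definition ncB : ncseries := ncvar false.

Definition ncsub (f g : ncseries) : ncseries := fun w => f w - g w.
Definition ncscale (c : rat) (f : ncseries) : ncseries := fun w => c * f w.

Definition ncmul (f g : ncseries) : ncseries :=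
  fun w => \sum_(i < (size w).+1) f (take i w) * g (drop i w).
Definition ncpow (f : ncseries) (k : nat) : ncseries := iter k (ncmul f) nc1.

(* The infinite sum of the F k, for families such that F k has no word of
   length < k: then only the terms k <= size w contribute to the coefficient
   of w (see [ncsumE]).  The families summed in [ncexp f] and [nclog g] satisfy
   this as soon as f, resp. g - 1, has zero constant term (see [ncpow_low]). *)
Definition ncsum (F : nat -> ncseries) : ncseries :=
  fun w => \sum_(0 <= k < (size w).+1) F k w.

Definition ncexp (f : ncseries) : ncseries :=
  ncsum (fun k => ncscale (k`!%:R)^-1 (ncpow f k)).

(* The term k = 0 vanishes, since 0^-1 = 0 in rat. *)
Definition nclog (g : ncseries) : ncseries :=
  ncsum (fun k => ncscale ((-1) ^+ k.+1 / k%:R) (ncpow (ncsub g nc1) k)).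

Definition bch : ncseries := nclog (ncmul (ncexp ncA) (ncexp ncB)).

Lemma ncsumE (F : nat -> ncseries) (w : word) (N : nat) :
    (forall k, (size w < k)%N -> F k w = 0) -> (size w < N)%N ->
  \sum_(0 <= k < N) F k w = ncsum F w.
Proof.
move=> F0 ltN; rewrite /ncsum (big_cat_nat (n := (size w).+1)) //= [X in _ + X]big_nat_cond.
by rewrite [X in _ + X]big1 ?addr0 // => k /andP[/andP[/F0]].
Qed.

Lemma ncpow_low (f : ncseries) (k : nat) (w : word) :
  f [::] = 0 -> (size w < k)%N -> ncpow f k w = 0.
Proof.
move=> f0; elim: k w => [//|k IHk] w ltwk.
rewrite /ncpow iterS -/(ncpow f k) /ncmul big1 // => -[[|i] /= lti] _.
  by rewrite take0 f0 mul0r.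
rewrite IHk ?mulr0 // size_drop; case: w ltwk lti => [|a w] //= ltwk _.
by rewrite subSS (leq_ltn_trans (leq_subr _ _)).
Qed.

Lemma bch_const : ncsub (ncmul (ncexp ncA) (ncexp ncB)) nc1 [::] = 0.
Proof.
by rewrite /ncsub /ncmul big_ord1 /ncexp /ncsum /= !big_nat1 /ncscale
           /ncpow /= /nc1 eqxx !fact0 invr1 !mulr1 subrr.
Qed.

Definition denom (r : rat) : nat := `|denq r|%N.

(* trunc_log p m is the largest t with p ^ t <= m (for p > 1, m > 0). *)
Definition digit_sum (p n : nat) : nat :=
  (\sum_(0 <= i < (trunc_log p n).+1) (n %/ p ^ i) %% p)%N.
Definition l_ (n p : nat) : nat := trunc_log p (digit_sum p n).
Definition d_ (n : nat) : nat := (\prod_(0 <= p < n | prime p) p ^ l_ n p)%N.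

(* Main.v *)
Require Import Defs.
From mathcomp Require Import all_boot all_order all_algebra cyclic.
From mathcomp Require Import zify ring.
Set Implicit Arguments.
Unset Strict Implicit.
Unset Printing Implicit Defensive.
Import Order.TTheory GRing.Theory Num.Theory.

(** Fix a prime p and put U = e^A e^B - 1, so that the coefficient of w in H is
    the sum over k of (-1)^(k+1)/k [w]U^k.

    Upper bound: n! [w]U^k is an integer, and by Legendre's formula
    (p-1) v(i!) = i - s_p(i) the valuation of [w]U^k is at least -(n-k)/(p-1).
    The first fact handles the k with v(k) <= l(n,p), the second one the others.

    Lower bound, for p <= n: by Goldberg's theorem, if w has runs of lengths
    r_1, ..., r_m and D = prod r_i!, then D [w]U^k is the coefficient of X^k in an
    explicit integer polynomial Q, a product over the runs whose factors depend,
    modulo p, only on r_i modulo p-1.  Write n as a sum of sigma powers of p with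
    p^L <= sigma <= p^(L+1) - p and v(D) + L = v(n!) + l(n,p): either sigma = s_p(n)
    and L = l(n,p), or, when s_p(n) is too large for this, one power is split into p
    equal parts, so that sigma = s_p(n) + p - 1 and L = l(n,p) + 1.  Merge the surplus
    powers into a single run followed by p^L (for p = 2: 2^L - 1) runs of p-power
    length.  Modulo p only k = p^L then contributes to D p^L [w]H, and its
    contribution is a unit: it is 1, or q^x with q = (p^L + 1)/2 and x the length
    of the merged run. *)

(** * Digit sums and Legendre's formula *)

Section DigitSum.
Variable p : nat.
Hypothesis p_pr : prime p.

Lemma digit_sum_widen n T :
  n < p ^ T -> digit_sum p n = \sum_(0 <= i < T) (n %/ p ^ i) %% p.
Proof.
move=> ltnT; have p_gt1 := prime_gt1 p_pr.
have van i : n < p ^ i -> (n %/ p ^ i) %% p = 0 by move=> /divn_small->; rewrite mod0n.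
have vanishes a b : n < p ^ a -> \sum_(a <= i < b) (n %/ p ^ i) %% p = 0.
  move=> lta; rewrite big_nat big1 // => i /andP[lei _]; apply: van.
  by apply: leq_trans lta _; rewrite leq_exp2l.
rewrite /digit_sum; have [le|lt] := leqP (trunc_log p n).+1 T.
  rewrite [RHS](big_cat_nat (n := (trunc_log p n).+1)) //=.
  by rewrite [X in _ = _ + X]vanishes ?addn0 ?trunc_log_ltn.
by rewrite [LHS](big_cat_nat (n := T)) ?[X in _ + X = _]vanishes ?addn0 //= ltnW.
Qed.

Lemma legendre n : p.-1 * logn p n`! + digit_sum p n = n.
Proof.
have p_gt1 := prime_gt1 p_pr; have p_gt0 := prime_gt0 p_pr.
have ltn : n < p ^ n.+1 by apply: leq_trans (ltn_expl _ p_gt1) _; rewrite leq_exp2l.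
rewrite logn_fact // (digit_sum_widen ltn).
(* Division of [n %/ p ^ i] by [p], summed over [i]: the quotients are the next floors, the
   remainders the digits. *)
have E : p * (\sum_(1 <= k < n.+1) n %/ p ^ k) + \sum_(0 <= i < n.+1) (n %/ p ^ i) %% p
  = \sum_(0 <= i < n.+1) n %/ p ^ i.
  have -> : \sum_(1 <= k < n.+1) n %/ p ^ k = \sum_(0 <= k < n.+1) n %/ p ^ k.+1.
    rewrite [RHS]big_nat_recr //= (divn_small ltn) addn0.
    by rewrite big_add1.
  rewrite big_distrr -big_split; apply: eq_bigr => i _ /=.
  by rewrite expnSr divnMA mulnC -divn_eq.
move: E; rewrite [in RHS]big_ltn // expn0 divn1.
set V := \sum_(1 <= k < _) _; set S := \sum_(0 <= i < _) _.
move=> E; apply: (@addnI V); rewrite addnA -mulSn prednK // E addnC //.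
Qed.

(** [a! b!] divides [(a + b)!]; Legendre's formula turns this into digit sums. *)
Lemma digit_sum_subadd a b : digit_sum p (a + b) <= digit_sum p a + digit_sum p b.
Proof.
have le : logn p a`! + logn p b`! <= logn p (a + b)`!.
  rewrite -lognM ?fact_gt0 // dvdn_leq_log ?fact_gt0 //.
  have := @bin_fact (a + b) a (leq_addr b a); rewrite addKn => <-.
  exact: dvdn_mull.
have := legendre a; have := legendre b; have := legendre (a + b).
have : p.-1 * (logn p a`! + logn p b`!) <= p.-1 * logn p (a + b)`! by rewrite leq_mul2l le orbT.
rewrite mulnDr; lia.
Qed.

Lemma digit_sum0 : digit_sum p 0 = 0.
Proof. by have := legendre 0; rewrite fact0 logn1 muln0. Qed.

Lemma digit_sum_modn n : n = digit_sum p n %[mod p.-1].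
Proof. by rewrite -{1}(legendre n) -modnDml modnMr add0n. Qed.

Lemma digit_sum_gt0 n : 0 < n -> 0 < digit_sum p n.
Proof.
move=> n_gt0; rewrite lt0n; apply/negP => /eqP s0.
have p_gt1 := prime_gt1 p_pr; have := trunc_logP p_gt1 n_gt0.
have := trunc_log_ltn n p_gt1; set t := trunc_log p n => ltn len.
move: s0; rewrite /digit_sum big_nat_recr //= -/t => /eqP; rewrite addn_eq0 => /andP[_].
rewrite modn_small ?ltn_divLR ?expn_gt0 ?(ltnW p_gt1) // -?expnS //.
by rewrite -leqn0 leqNgt divn_gt0 ?len // expn_gt0 (ltnW p_gt1).
Qed.

Lemma digit_sum_lt n : n < p -> digit_sum p n = n.
Proof. by move=> ltn; rewrite (@digit_sum_widen n 1) ?expn1 // big_nat1 divn1 modn_small. Qed.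

Lemma logn_fact_le n : 0 < n -> p.-1 * logn p n`! < n.
Proof. by move=> /digit_sum_gt0; have := legendre n; lia. Qed.

(** Exponents are listed with repetition, so [size E] counts the powers; run lengths come from such
    lists. *)
Definition powsum (E : seq nat) := \sum_(e <- E) p ^ e.

Lemma powsum_modn E : powsum E = size E %[mod p.-1].
Proof.
have p1 : p = 1 %[mod p.-1] by rewrite -{1}(prednK (prime_gt0 p_pr)) -addn1 modnDl.
rewrite /powsum; elim: E => [|e E IH]; first by rewrite big_nil.
by rewrite big_cons /= -modnDm IH -modnXm p1 modnXm exp1n modnDm add1n.
Qed.

Lemma digit_sum_exp_le e : digit_sum p (p ^ e) <= 1.
Proof.
have p_gt1 := prime_gt1 p_pr.
rewrite (@digit_sum_widen _ e.+1); last by rewrite ltn_exp2l.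
rewrite big_nat_recr //= divnn expn_gt0 (ltnW p_gt1) /=.
rewrite big_nat big1 ?add0n; first exact: leq_mod.
move=> i /andP[_ lti]; rewrite -expnB ?(ltnW p_gt1) 1?ltnW //.
by apply/eqP; rewrite -/(_ %| _) -{1}(expn1 p) dvdn_exp2l // subn_gt0.
Qed.

Lemma digit_sum_powsum E : digit_sum p (powsum E) <= size E.
Proof.
rewrite /powsum; elim: E => [|e E IH]; first by rewrite big_nil digit_sum0.
by rewrite big_cons; apply: leq_trans (digit_sum_subadd _ _) _; apply: leq_add (digit_sum_exp_le e) IH.
Qed.

Lemma digit_sum_exp e : digit_sum p (p ^ e) = 1.
Proof.
apply/eqP; rewrite eqn_leq digit_sum_exp_le digit_sum_gt0 //.
by rewrite expn_gt0 prime_gt0.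
Qed.

Lemma powsum_cat E F : powsum (E ++ F) = powsum E + powsum F.
Proof. exact: big_cat. Qed.

Lemma powsum_exists n : exists2 E, powsum E = n & size E = digit_sum p n.
Proof.
exists (flatten [seq nseq ((n %/ p ^ i) %% p) i | i <- iota 0 (trunc_log p n).+1]).
  rewrite /powsum big_flatten big_map.
  under eq_bigr => i _ do rewrite big_nseq.
  have expand t m : m < p ^ t -> \sum_(i <- iota 0 t) p ^ i * ((m %/ p ^ i) %% p) = m.
    elim: t m => [|t IH] m; first by rewrite ltnS leqn0 big_nil => /eqP->.
    rewrite /= big_cons expn0 divn1 mul1n -[1]addn0 iotaDl big_map => ltm.
    rewrite [RHS](divn_eq m p) addnC; congr (_ + _).
    rewrite -[in RHS](IH (m %/ p)) ?ltn_divLR ?prime_gt0 -?expnSr // big_distrl /=.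
    by apply: eq_bigr => i _; rewrite add1n expnS divnMA -mulnA mulnC.
  by under eq_bigr => i _ do rewrite iter_addn_0; apply/expand/trunc_log_ltn/prime_gt1.
rewrite size_flatten /shape -map_comp sumnE big_map /digit_sum /index_iota subn0.
by apply: eq_bigr => i _; rewrite /= size_nseq.
Qed.

(* Without a carry-free total, the congruence modulo [p - 1] still excludes
   carries in sums of fewer than [p] powers. *)
Lemma digit_sum_powsum_eq E F :
  digit_sum p (powsum (E ++ F)) = size (E ++ F) \/ size E < p ->
  digit_sum p (powsum E) = size E.
Proof.
case=> [|ltE].
  rewrite powsum_cat size_cat; have := digit_sum_subadd (powsum E) (powsum F).
  by have := digit_sum_powsum E; have := digit_sum_powsum F; lia.
have [E0|E_gt0] := posnP (size E).
  by rewrite (size0nil E0) /powsum big_nil digit_sum0.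
have pE_gt0 : 0 < powsum E.
  case: E E_gt0 {ltE} => // e E _; rewrite /powsum big_cons.
  by rewrite ltn_addr // expn_gt0 prime_gt0.
have := digit_sum_gt0 pE_gt0; have := digit_sum_powsum E.
have := digit_sum_modn (powsum E); rewrite powsum_modn => /eqP.
set s := digit_sum _ _ => eqm les s_gt0; move: eqm.
rewrite eqn_mod_dvd // => /dvdnP[[|k] Ek]; first by lia.
by have := prime_gt1 p_pr; move: Ek; rewrite mulSn; lia.
Qed.

End DigitSum.

Local Open Scope ring_scope.

(** * p-integral rational numbers *)

(** Membership in the localization of the integers at [p]. *)
Definition pint (p : nat) (r : rat) : bool := ~~ (p %| denom r)%N.

Section PIntegral.
Variable p : nat.
Hypothesis p_pr : prime p.

Lemma dvd_denom (r : rat) (d : nat) (m : int) : r * d%:R = m%:~R -> (denom r %| d)%N.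
Proof.
move=> rdm; have E : numq r * d%:Z = m * denq r.
  apply: (@intr_inj rat); rewrite !rmorphM /= -rdm numqE.
  by rewrite mulrAC.
have : (denq r %| numq r * d%:Z)%Z by rewrite E dvdz_mull.
by rewrite Gauss_dvdzr ?dvdzE // coprimezE coprime_sym coprime_num_den.
Qed.

Lemma pintP (r : rat) :
  reflect (exists d (m : int), ~~ (p %| d)%N /\ r * d%:R = m%:~R) (pint p r).
Proof.
apply: (iffP idP) => [pr|[d [m [pd rdm]]]].
  exists (denom r), (numq r); split=> //.
  by rewrite numqE /denom -[in RHS]absz_denq.
by apply: contra pd => /dvdn_trans; apply; apply: dvd_denom rdm.
Qed.

Lemma pint_int (m : int) : pint p m%:~R.
Proof. by apply/pintP; exists 1%N, m; rewrite mulr1 dvdn1 -(negbK (p == _)) neq_ltn prime_gt1 ?orbT. Qed.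

Lemma pint_nat (n : nat) : pint p n%:R.
Proof. exact: (pint_int n). Qed.

Lemma pintD r s : pint p r -> pint p s -> pint p (r + s).
Proof.
move=> /pintP[d [m [pd rd]]] /pintP[e [n [pe se]]]; apply/pintP.
exists (d * e)%N, (m * e%:Z + n * d%:Z); split; first by rewrite Euclid_dvdM // negb_or pd.
by rewrite natrM [RHS]rmorphD !rmorphM /= -rd -se; ring.
Qed.

Lemma pintM r s : pint p r -> pint p s -> pint p (r * s).
Proof.
move=> /pintP[d [m [pd rd]]] /pintP[e [n [pe se]]]; apply/pintP.
exists (d * e)%N, (m * n); split; first by rewrite Euclid_dvdM // negb_or pd.
by rewrite natrM [RHS]rmorphM /= -rd -se; ring.
Qed.

Lemma pintN r : pint p (- r) = pint p r.
Proof. by rewrite /pint /denom denqN. Qed.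

Lemma pint_sum (I : Type) (t : seq I) (P : pred I) (F : I -> rat) :
  (forall i, P i -> pint p (F i)) -> pint p (\sum_(i <- t | P i) F i).
Proof. by move=> H; apply: (big_ind (pint p)) => //; [exact: (pint_int 0) | exact: pintD]. Qed.

Lemma pint_invn (n : nat) : ~~ (p %| n)%N -> pint p n%:R^-1.
Proof.
move=> pn; apply/pintP; exists n, 1; split => //.
by rewrite mulVf // pnatr_eq0; apply: contraNneq pn => ->.
Qed.

Lemma pint_divn (m n : nat) : (logn p n <= logn p m)%N -> pint p (m%:R / n%:R).
Proof.
move=> le; have [->|m_gt0] := posnP m; first by rewrite mul0r (pint_int 0).
have [->|n_gt0] := posnP n; first by rewrite invr0 mulr0 (pint_int 0).
have [m' pm' ->] := pfactor_coprime p_pr m_gt0.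
have [n' pn' ->] := pfactor_coprime p_pr n_gt0.
have -> : (m' * p ^ logn p m)%:R / (n' * p ^ logn p n)%:R =
   (m' * p ^ (logn p m - logn p n))%:R / n'%:R :> rat.
  rewrite -{1}(subnK le) expnD mulnA !natrM -[RHS]mulrA invfM mulrACA -!mulrA.
  rewrite divff ?mulr1 // pnatr_eq0 -lt0n expn_gt0 prime_gt0 //.
apply: pintM; first exact: pint_nat.
by apply: pint_invn; rewrite -prime_coprime.
Qed.

(** Reduces both bounds on denominators to p-integrality, which sums and products preserve. *)
Lemma logn_denom_le (r : rat) e : (logn p (denom r) <= e)%N = pint p ((p ^ e)%:R * r).
Proof.
have d_gt0 : (0 < denom r)%N by rewrite absz_gt0 denq_neq0.
apply/idP/idP => [le|/pintP[d [m [pd E]]]].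
  have -> : r = (numq r)%:~R / (denom r)%:R.
    by rewrite -{1}(divq_num_den r) /denom -[in LHS]absz_denq.
  rewrite mulrCA; apply: pintM; first exact: pint_int.
  by apply: pint_divn; rewrite pfactorK.
have d0 : (0 < d)%N by rewrite lt0n; apply: contraNneq pd => ->.
have /(dvdn_leq_log p) : (denom r %| p ^ e * d)%N.
  by apply: (@dvd_denom r (p ^ e * d)%N m); rewrite -E (natrM _ (p ^ e)%N); ring.
rewrite muln_gt0 expn_gt0 prime_gt0 // d0 => /(_ isT) le; apply: leq_trans le _.
by rewrite lognM ?d0 ?expn_gt0 ?(prime_gt0 p_pr) // pfactorK // (logn_coprime) ?addn0 // prime_coprime.
Qed.

End PIntegral.

(** * The upper bound *)

Lemma ncmul_nil f g : ncmul f g [::] = f [::] * g [::].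
Proof. by rewrite /ncmul big_ord1. Qed.

Lemma ncmul_cons f g a w :
  ncmul f g (a :: w) = f [::] * g (a :: w) + ncmul (fun u => f (a :: u)) g w.
Proof. by rewrite /ncmul big_ord_recl. Qed.

Lemma ncpow_var a k w : ncpow (ncvar a) k w = (w == nseq k a)%:R.
Proof.
elim: k w => [//|k IH] [|b w]; rewrite /ncpow iterS -/(ncpow _ k) ?ncmul_nil ?mul0r //.
rewrite ncmul_cons mul0r add0r /= eqseq_cons; case: w => [|c w].
  by rewrite ncmul_nil IH /ncvar eqseq_cons andbT -natrM mulnb.
rewrite ncmul_cons [ncmul _ _ _]big1 ?addr0 => [|i _]; last first.
  by rewrite /ncvar eqseq_cons andbF mul0r.
by rewrite IH /ncvar eqseq_cons andbT -natrM mulnb.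
Qed.

Lemma ncexp_var a w : ncexp (ncvar a) w = (w == nseq (size w) a)%:R / (size w)`!%:R.
Proof.
rewrite /ncexp /ncsum big_nat_recr //= /ncscale ncpow_var mulrC big_nat big1 ?add0r // => k.
move=> /andP[_ ltk]; rewrite ncpow_var; case: eqP => [E|]; last by rewrite mulr0.
by move: ltk; rewrite E size_nseq ltnn.
Qed.

Definition fact_integral (f : ncseries) := forall w, (size w)`!%:R * f w \is a Num.int.

(** A cut after [i] letters contributes the integer ['C(size w, i)]. *)
Lemma fact_integral_mul f g : fact_integral f -> fact_integral g -> fact_integral (ncmul f g).
Proof.
move=> fi gi w; rewrite /ncmul mulr_sumr rpred_sum // => i _.
have lei : (i <= size w)%N by rewrite -ltnS ltn_ord.
have -> : (size w)`!%:R * (f (take i w) * g (drop i w)) = 'C(size w, i)%:R *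
    (((size (take i w))`!%:R * f (take i w)) * ((size (drop i w))`!%:R * g (drop i w))).
  by rewrite -(bin_fact lei) !natrM size_takel // size_drop; ring.
by apply: rpredM; [exact: rpred_nat | exact: rpredM].
Qed.

Lemma fact_integral_nc1 : fact_integral nc1.
Proof. by move=> w; rewrite /nc1 -natrM rpred_nat. Qed.

Lemma fact_integral_exp a : fact_integral (ncexp (ncvar a)).
Proof. by move=> w; rewrite ncexp_var mulrCA divff ?mulr1 // pnatr_eq0 -lt0n fact_gt0. Qed.

Definition bchU : ncseries := ncsub (ncmul (ncexp ncA) (ncexp ncB)) nc1.

Lemma fact_integral_bchU : fact_integral bchU.
Proof.
move=> w; rewrite mulrBr rpredB ?fact_integral_nc1 //.
exact: fact_integral_mul (fact_integral_exp _) (fact_integral_exp _) w.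
Qed.

Lemma fact_integral_pow f k : fact_integral f -> fact_integral (ncpow f k).
Proof.
move=> fi; elim: k => [|k IH]; first exact: fact_integral_nc1.
exact: fact_integral_mul.
Qed.

Section Order.
Variable p : nat.
Hypothesis p_pr : prime p.

Lemma fact_integral_pint f w : fact_integral f ->
  pint p ((p ^ logn p (size w)`!)%:R * f w).
Proof.
move=> /(_ w)/intrP[m E]; have n0 : (size w)`!%:R != 0 :> rat by rewrite pnatr_eq0 -lt0n fact_gt0.
have -> : f w = m%:~R / (size w)`!%:R by rewrite -E mulrAC divff // mul1r.
rewrite mulrCA; apply: pintM => //; first exact: pint_int.
by apply: pint_divn => //; rewrite pfactorK.
Qed.

(** The second valuation estimate in multiplicative form: the exponents add up along a product, so
    the powers of [bchU] inherit the estimate. *)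
Definition low_order d (f : ncseries) := forall w,
  if (d <= size w)%N then pint p ((p ^ ((size w - d) %/ p.-1))%:R * f w) else f w == 0.

Lemma low_order_mul a b f g :
  low_order a f -> low_order b g -> low_order (a + b) (ncmul f g).
Proof.
move=> fa gb w; rewrite /ncmul.
have szd (i : 'I_(size w).+1) : size w = (size (take i w) + size (drop i w))%N.
  by rewrite -size_cat cat_take_drop.
case: leqP => ltw; last first.
  apply/eqP/big1 => i _; have := fa (take i w); have := gb (drop i w).
  case: leqP => [leb _|_ /eqP-> _]; last by rewrite mulr0.
  by case: leqP => [lea|_ /eqP->]; [have := szd i; lia | rewrite mul0r].
rewrite mulr_sumr; apply: pint_sum => // i _.
have := fa (take i w); have := gb (drop i w).
case: leqP => [leb|_ /eqP-> _]; last by rewrite !mulr0; apply: (pint_int p_pr 0).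
case: leqP => [lea|_ _ /eqP->]; last by rewrite mul0r mulr0; apply: (pint_int p_pr 0).
set x := (size (take i w) - a)%N; set y := (size (drop i w) - b)%N => gi fi.
have le : (x %/ p.-1 + y %/ p.-1 <= (size w - (a + b)) %/ p.-1)%N.
  have -> : (size w - (a + b) = x + y)%N by rewrite (szd i) /x /y; lia.
  by rewrite divnD ?leq_addr //; have := prime_gt1 p_pr; lia.
rewrite -(subnK le) !expnD !natrM -mulrA mulrACA; apply: pintM => //.
  exact: pint_nat.
exact: pintM.
Qed.

Lemma low_order_nc1 : low_order 0 nc1.
Proof.
case=> [|a w] /=; first by rewrite div0n mulr1; apply: (pint_nat p_pr).
by rewrite mulr0; apply: (pint_int p_pr 0).
Qed.

Lemma low_order_bchU : low_order 1 bchU.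
Proof.
move=> w; case: ltnP => [w_gt0|]; last by case: w => [|a w] // _; apply/eqP; exact: bch_const.
have le : (logn p (size w)`! <= (size w - 1) %/ p.-1)%N.
  rewrite leq_divRL; last by have := prime_gt1 p_pr; lia.
  by have := logn_fact_le p_pr w_gt0; lia.
rewrite -(subnK le) expnD natrM -mulrA; apply: pintM => //; first exact: pint_nat.
exact/fact_integral_pint/fact_integral_bchU.
Qed.

Lemma low_order_pow k : low_order k (ncpow bchU k).
Proof.
elim: k => [|k IH]; first exact: low_order_nc1.
exact: low_order_mul low_order_bchU IH.
Qed.

Lemma bchE w : bch w =
  \sum_(1 <= k < (size w).+1) (-1) ^+ k.+1 / k%:R * ncpow bchU k w.
Proof. by rewrite /bch /nclog /ncsum big_ltn // /ncscale invr0 mulr0 mul0r add0r. Qed.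

Lemma pint_sign k r : pint p ((-1) ^+ k * r) = pint p r.
Proof. by rewrite -signr_odd; case: odd; rewrite ?mul1r // mulN1r pintN. Qed.

(** For [k] divisible by a high power of [p], this shows that the loss from dividing by [k] is
    offset by the size of [k]. *)
Lemma expn_sub_ge a b : (p.-1 * b <= p ^ (a + b) - p ^ a)%N.
Proof.
have p_gt1 := prime_gt1 p_pr.
rewrite expnD -{2}(muln1 (p ^ a)%N) -mulnBr.
have le : (p.-1 * b <= p ^ b - 1)%N.
  elim: b => [|b]; first by rewrite muln0.
  rewrite mulnS expnS; have : (0 < p ^ b)%N by rewrite expn_gt0 ltnW.
  move: (p ^ b)%N => x x0 IH; apply: (@leq_trans (p.-1 * x + (x - 1))).
    by apply: leq_add IH; rewrite -{1}[p.-1]muln1 leq_mul2l x0 orbT.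
  by rewrite addnBA // -mulSnr prednK // ltnW.
by apply: leq_trans le _; apply: leq_pmull; rewrite expn_gt0 ltnW.
Qed.

Lemma denom_bch_le w :
  (0 < size w)%N -> (logn p (denom (bch w)) <= logn p (size w)`! + l_ (size w) p)%N.
Proof.
move=> w_gt0; have p_gt1 := prime_gt1 p_pr.
have s_gt0 := digit_sum_gt0 p_pr w_gt0.
rewrite logn_denom_le // bchE mulr_sumr big_nat_cond; apply: pint_sum => // k.
rewrite andbT => /andP[k_gt0 lek]; rewrite ltnS in lek.
rewrite -mulrA mulrCA pint_sign; set c := ncpow _ _ _; set n := size w.
have [le|lt] := leqP (logn p k) (l_ n p).
  rewrite expnD natrM [_ * c]mulrC mulrACA; apply: pintM => //.
    exact/(@fact_integral_pint (ncpow bchU k))/fact_integral_pow/fact_integral_bchU.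
  by apply: pint_divn => //; rewrite pfactorK.
have := low_order_pow k w; rewrite lek => pc.
(* As [k >= p ^ v(k)], the bounds [expn_sub_ge] and [s_p(n) < p ^ (l + 1)] give
   [n - k < (p - 1) (v(n!) + l + 1 - v(k))] by Legendre's formula. *)
have tb : ((n - k) %/ p.-1 + logn p k <= logn p n`! + l_ n p)%N.
  have pk : (p ^ logn p k <= k)%N by rewrite dvdn_leq // pfactor_dvdnn.
  have := expn_sub_ge (l_ n p).+1 (logn p k - (l_ n p).+1); rewrite subnKC //.
  have := trunc_log_ltn (digit_sum p n) p_gt1; rewrite -/(l_ n p).
  have := legendre p_pr n; have : (p ^ (l_ n p).+1 <= p ^ logn p k)%N by rewrite leq_exp2l.
  move: (p ^ _.+1)%N (p ^ _)%N pk => X Y pk leXY L SX XY.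
  have := leq_divM (n - k) p.-1; move: (_ %/ _)%N => D qD.
  rewrite leqNgt; apply/negP => ltD.
  have : (p.-1 * logn p n`! <= p.-1 * (D + (logn p k - (l_ n p).+1)))%N.
    by rewrite leq_mul2l; apply/orP; right; lia.
  by rewrite mulnDr (mulnC _ D); lia.
rewrite -(subnK tb) !expnD !natrM -mulrA; apply: pintM => //; first exact: pint_nat.
rewrite [_ * c]mulrC mulrACA; apply: pintM => //.
by apply: pint_divn => //; rewrite pfactorK.
Qed.

End Order.

(** * Goldberg's theorem *)

(* The number of surjections from a set of size [r] onto a set of size [k]. *)
Fixpoint surj (k r : nat) : nat :=
  if k is k'.+1 then \sum_(i < r) 'C(r, i) * surj k' i else r == 0.

Lemma surj_small k r : (r < k)%N -> surj k r = 0%N.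
Proof.
elim: k r => // k IH r ltr /=; apply: big1 => i _.
by rewrite IH ?muln0 // (leq_trans (ltn_ord i)).
Qed.

Section Gold.
Variable R : comNzRingType.

(** The ordered Bell polynomial: [surj k r] is [r!] times the coefficient of [t^r] in [(e^t - 1)^k],
    so it records how [k] factors share out a run. *)
Definition runphi r : {poly R} := \poly_(k < r.+1) (surj k r)%:R.
(** By the recursion of [surj], this is [runphi r] divided by ['X] when [0 < r]: one block is left
    uncounted, as it may be shared with the next run. *)
Definition runpsi r : {poly R} := \sum_(i < r) runphi i *+ 'C(r, i).

Lemma coef_runphi r k : (runphi r)`_k = (surj k r)%:R.
Proof. by rewrite coef_poly ltnS; case: leqP => // /surj_small->. Qed.

Lemma coef_runpsi r k : (runpsi r)`_k = (surj k.+1 r)%:R.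
Proof.
rewrite coef_sum natr_sum; apply: eq_bigr => i _.
by rewrite coefMn coef_runphi natrM mulr_natl.
Qed.

Lemma runphi0 : runphi 0 = 1.
Proof. by apply/polyP=> k; rewrite coef_runphi coef1; case: k => //= k; rewrite big_ord0. Qed.

Lemma runphiE r : (0 < r)%N -> runphi r = 'X * runpsi r.
Proof.
move=> r_gt0; apply/polyP=> k; rewrite coef_runphi coefXM coef_runpsi.
by case: k => //=; case: r r_gt0.
Qed.

(* A run of [A] followed by a run of [B] may or may not share a factor
   [A^i B^j], which accounts for the factor [1 + 'X] instead of ['X]. *)
Fixpoint gold (b : bool) (rs : seq nat) : {poly R} :=
  if rs is r :: rs' then ((b && (rs' != [::]))%:R + 'X) * runpsi r * gold (~~ b) rs'
  else 1.

(** Shaped to match [ncmul_bchU_run]: a prefix cut off the run leaves [j] letters, with factor 1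
    once the run is exhausted, and the lone [e] stands for a prefix going past its end. *)
Lemma runpsi_rec (e : bool) r : (0 < r)%N ->
  (e%:R + 'X) * runpsi r =
  e%:R + 'X * \sum_(j < r) (if j == 0%N :> nat then 1 else (e%:R + 'X) * runpsi j) *+ 'C(r, j).
Proof.
case: r => // r _; rewrite /runpsi big_ord_recl [in RHS]big_ord_recl /= runphi0 bin0.
rewrite !mulrDr !mulr1 addrA; congr (_ + _); rewrite !mulr_sumr; apply: eq_bigr => j _.
by rewrite runphiE // !mulrnAr -/(runpsi _); congr (_ *+ _); ring.
Qed.

End Gold.

(** Links the integer polynomial to [rat], where it yields coefficients of powers of [bchU], and to
    ['F_p], where it is computed. *)
Lemma map_gold (R S : comNzRingType) (f : {rmorphism R -> S}) b rs :
  map_poly f (gold R b rs) = gold S b rs.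
Proof.
elim: rs b => [|r rs IH] b /=; first by rewrite rmorph1.
rewrite !rmorphM /= IH rmorphD rmorph_nat /= map_polyX; congr (_ * _ * _).
by apply/polyP=> k; rewrite coef_map /= !coef_runpsi; apply: rmorph_nat.
Qed.

Fixpoint altw (b : bool) (rs : seq nat) : word :=
  if rs is r :: rs' then nseq r b ++ altw (~~ b) rs' else [::].

Lemma size_altw b rs : size (altw b rs) = sumn rs.
Proof. by elim: rs b => //= r rs IH b; rewrite size_cat size_nseq IH. Qed.

(** The empty word starts with either letter, so the end of the last run needs no separate
    treatment. *)
Definition starts (b : bool) (w : word) := if w is a :: _ then a == b else true.

Lemma starts_altw b rs : all (leq 1) rs -> starts b (altw b rs).
Proof. by case: rs => [|[|r] rs] //= _. Qed.

Lemma ncmul_nseq f g a r w : ncmul f g (nseq r a ++ w) =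
  \sum_(i < r) f (nseq i a) * g (nseq (r - i) a ++ w) + ncmul (fun u => f (nseq r a ++ u)) g w.
Proof.
elim: r f => [|r IH] f /=; first by rewrite big_ord0 add0r.
by rewrite ncmul_cons IH big_ord_recl /= addrA.
Qed.

Lemma ncmul_head f g b w : starts b w -> (forall u, f (b :: u) = 0) ->
  ncmul f g w = f [::] * g w.
Proof.
case: w => [|a w] /=; first by rewrite ncmul_nil.
by move=> /eqP-> f0; rewrite ncmul_cons [X in _ + X]big1 ?addr0 // => i _; rewrite f0 mul0r.
Qed.

Lemma eq_ncmul f f' g b w : starts b w -> f [::] = f' [::] ->
  (forall u, f (b :: u) = f' (b :: u)) -> ncmul f g w = ncmul f' g w.
Proof.
case: w => [|a w] /=; first by rewrite !ncmul_nil => _ ->.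
by move=> /eqP-> f0 E; rewrite !ncmul_cons f0; congr (_ + _); apply: eq_bigr => i _; rewrite E.
Qed.

Lemma ncmul_nc1 g w : ncmul nc1 g w = g w.
Proof.
case: w => [|b w]; first by rewrite ncmul_nil mul1r.
by rewrite (@ncmul_head _ _ b) ?mul1r //= eqxx.
Qed.

Definition ncG : ncseries := ncmul (ncexp ncA) (ncexp ncB).

Lemma ncexp_nseq a r : ncexp (ncvar a) (nseq r a) = r`!%:R^-1.
Proof. by rewrite ncexp_var size_nseq eqxx mul1r. Qed.

Lemma ncexp_mixed a b r u : b != a -> ncexp (ncvar a) (nseq r a ++ b :: u) = 0.
Proof.
move=> ba; rewrite ncexp_var; case: eqP => [/(congr1 (all (pred1 a)))|]; last by rewrite mul0r.
by rewrite all_cat /= !all_nseq /= eqxx !orbT (negPf ba).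
Qed.

(** Only the cut right after the run counts: an earlier one leaves an [A] to [e^B], a later one a
    [B] to [e^A]. *)
Lemma ncG_A r u : starts false u -> ncG (nseq r true ++ u) = r`!%:R^-1 * ncexp ncB u.
Proof.
move=> su; rewrite /ncG ncmul_nseq big1 ?add0r => [|i _].
  rewrite (ncmul_head _ su) ?cats0 ?ncexp_nseq // => v; exact: (@ncexp_mixed true false).
have -> : (r - i)%N = (r - i).-1.+1 by rewrite prednK // subn_gt0.
by rewrite [ncexp ncB _](@ncexp_mixed false true 0) ?mulr0.
Qed.

Lemma ncG_AB r u : starts false u -> ncG (nseq r true ++ u) = r`!%:R^-1 * ncG u.
Proof.
by move=> su; rewrite ncG_A // -[u in RHS]cat0s (@ncG_A 0) // fact0 invr1 mul1r.
Qed.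

Lemma ncG_nseq a r : ncG (nseq r a) = r`!%:R^-1.
Proof.
case: a; first by rewrite -[nseq _ _]cats0 ncG_A // (ncexp_nseq false 0) fact0 invr1 mulr1.
case: r => [|r]; first by rewrite (@ncG_A 0 [::]) // (ncexp_nseq false 0) fact0 invr1 mulr1.
by rewrite (@ncG_A 0 (nseq r.+1 false)) // [ncexp ncB _](ncexp_nseq false) fact0 invr1 mul1r.
Qed.

Lemma ncG_BA r u : ncG (nseq r.+1 false ++ true :: u) = 0.
Proof.
rewrite (@ncG_A 0 (nseq r.+1 false ++ true :: u)) //.
by rewrite [ncexp ncB _](@ncexp_mixed false true r.+1) // mulr0.
Qed.

(** The prefix given to [bchU] either stops within the run, leaving [j] letters, or goes past it;
    the latter needs a run of [A], since [e^A e^B] has no [B] before an [A]. *)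
Lemma ncmul_bchU_run b r w g : (0 < r)%N -> starts (~~ b) w ->
  ncmul bchU g (nseq r b ++ w) =
  \sum_(j < r) (r - j)`!%:R^-1 * g (nseq j b ++ w)
  + (b && (w != [::]))%:R * (r`!%:R^-1 * ncmul bchU g w).
Proof.
move=> r_gt0 sw; have bchUE v : bchU v = ncG v - nc1 v by [].
have U0 : bchU [::] = 0 by exact: bch_const.
have Ub i : (0 < i)%N -> bchU (nseq i b) = i`!%:R^-1.
  by case: i => // i _; rewrite bchUE ncG_nseq subr0.
rewrite ncmul_nseq.
have -> : ncmul (fun u => bchU (nseq r b ++ u)) g w =
    r`!%:R^-1 * g w + (b && (w != [::]))%:R * (r`!%:R^-1 * ncmul bchU g w).
  case: b w sw Ub => [|] [|a w] //= sw Ub; rewrite ?mul0r ?addr0.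
  - by rewrite ncmul_nil cats0 Ub.
  - rewrite mul1r (@eq_ncmul _ (fun u => r`!%:R^-1 * (bchU u + nc1 u)) g false) //=.
    + rewrite -{1}[g _]ncmul_nc1 /ncmul !mulr_sumr -big_split.
      by apply: eq_bigr => i _ /=; ring.
    + by rewrite cats0 Ub // U0 add0r mulr1.
    + by move=> u; rewrite !bchUE ncG_AB // subrK; case: (r) r_gt0 => // r' _; rewrite /= subr0.
  - by rewrite ncmul_nil cats0 Ub.
  - rewrite (@ncmul_head _ g true (a :: w) sw) ?cats0 ?Ub // => u.
    by rewrite bchUE; case: (r) r_gt0 => // r' _; rewrite ncG_BA subr0.
rewrite addrA; congr (_ + _); case: r r_gt0 => // r _.
(* Prefix lengths are traded for remaining lengths: the empty prefix drops out as [bchU] has no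
   constant term, and the cut at the end of the run supplies [j = 0]. *)
rewrite big_ord_recl U0 mul0r add0r [in RHS]big_ord_recl subn0 addrC; congr (_ + _).
rewrite (reindex_inj rev_ord_inj); apply: eq_bigr => i _.
have ltir := ltn_ord i.
rewrite !lift0 Ub // subSS; congr (_`!%:R^-1 * g (nseq _ _ ++ _)) => /=; lia.
Qed.

Lemma altw_eq0 b rs : all (leq 1) rs -> (altw b rs == [::]) = (rs == [::]).
Proof. by case: rs => [|[|r] rs]. Qed.

Lemma coef0_gold (R : comNzRingType) b rs : rs != [::] -> (gold R b rs)`_0 = 0.
Proof.
elim: rs b => // r rs IH b _ /=; rewrite !coef0M coefD coefX -polyC_natr coefC addr0 /=.
by case: eqP => [|/eqP/IH->]; rewrite ?mulr0 // andbF !mul0r.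
Qed.

(* Induction on [k] through [U^k.+1 = U * U^k], cutting off a prefix of the word. *)
Lemma goldberg k b rs : all (leq 1) rs ->
  (\prod_(r <- rs) r`!)%:R * ncpow bchU k (altw b rs) = (gold rat b rs)`_k.
Proof.
elim: k b rs => [|k IH] b rs rs_gt0.
  rewrite /ncpow /= /nc1 altw_eq0 //.
  have [->|rs0] := eqVneq rs [::]; first by rewrite big_nil mulr1 coef1.
  by rewrite mulr0 coef0_gold.
(* A first factor going past the run keeps the exponent [k.+1] and shortens only the list, hence
   this inner induction. *)
elim: rs b rs_gt0 => [|r rs IHr] b; first by rewrite ncpow_low ?mulr0 ?coef1 //; apply: bch_const.
case/andP=> r_gt0 rs_gt0; rewrite [altw _ _]/= [ncpow _ _]/ncpow iterS -/(ncpow bchU k).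
rewrite ncmul_bchU_run ?starts_altw // -[ncmul _ _ (altw _ _)]/(ncpow bchU k.+1 _).
rewrite altw_eq0 // big_cons /=; set e := b && _; set D := (\prod_(i <- rs) i`!)%N.
set w := altw (~~ b) rs; set g := gold _ _ _.
have chi (j : nat) : D%:R * j`!%:R * ncpow bchU k (nseq j b ++ w) =
    ((if j == 0%N then 1 else (e%:R + 'X) * runpsi _ j) * g)`_k.
  case: j => [|j]; first by rewrite mulr1 mul1r IH.
  by rewrite -natrM mulnC; have := IH b (j.+1 :: rs); rewrite big_cons; apply.
rewrite runpsi_rec // mulrDl -mulrA coefD coefXM /= mulr_suml coef_sum addrC mulrDr.
congr (_ + _).
  rewrite -polyC_natr coefCM -IHr // -/D -/w natrM -[ncmul _ _ w]/(ncpow bchU k.+1 w).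
  have f0 : r`!%:R != 0 :> rat by rewrite pnatr_eq0 -lt0n fact_gt0.
  by field.
rewrite mulr_sumr; apply: eq_bigr => j _.
rewrite [in RHS]mulrnAl coefMn -chi -mulr_natl.
have lej := ltnW (ltn_ord j); rewrite -(bin_fact lej) !natrM.
have f0 : (r - j)`!%:R != 0 :> rat by rewrite pnatr_eq0 -lt0n fact_gt0.
by field.
Qed.

(** * Goldberg's polynomials modulo p *)

(* [q ^ r] counts the maps from [r] points to [q] points by their image. *)
Lemma surj_newton N r q : (r < N)%N ->
  (\sum_(k < N) surj k r * 'C(q, k))%N = (q ^ r)%N.
Proof.
elim: q N r => [|q IH] [//|N] r ltr.
  rewrite big_ord_recl bin0 muln1 big1 ?addn0 => [|i _]; last by rewrite bin0n muln0.
  by case: r {ltr} => //= r; rewrite exp0n.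
rewrite big_ord_recl bin0 muln1.
under eq_bigr => i _ do rewrite lift0 binS mulnDr.
rewrite big_split /= addnA.
have -> : ((r == 0%N) + \sum_(i < N) surj i.+1 r * 'C(q, i.+1))%N = (q ^ r)%N.
  by rewrite -(IH N.+1 r ltr) big_ord_recl bin0 muln1.
rewrite -[q.+1]add1n expnDn big_ord_recr /= binn subnn expn0 !mul1n addnC; congr (_ + _)%N.
under eq_bigr => i _ do rewrite big_distrl.
rewrite exchange_big; apply: eq_bigr => i _; rewrite exp1n mul1n.
rewrite -(IH N i) ?big_distrr /=; last exact: leq_trans (ltn_ord i) ltr.
by apply: eq_bigr => k _; rewrite mulnA.
Qed.

Section ModP.
Variable p : nat.
Hypothesis p_pr : prime p.

Lemma expn_modn_period k r r' : (0 < r)%N -> (0 < r')%N ->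
  r = r' %[mod p.-1] -> k ^ r = k ^ r' %[mod p].
Proof.
wlog le : r r' / (r <= r')%N => [hw|] r_gt0 r'_gt0 E.
  by have [le|/ltnW le] := leqP r r'; [exact: hw | symmetry; apply: hw].
have [pk|pk] := boolP (p %| k)%N.
  by rewrite (eqP (dvdn_exp r_gt0 pk)) (eqP (dvdn_exp r'_gt0 pk)).
have /dvdnP[a Ea] : (p.-1 %| r' - r)%N by rewrite -eqn_mod_dvd // E.
have kp : k ^ p.-1 = 1 %[mod p].
  by rewrite -(totient_prime p_pr) Euler_exp_totient // coprime_sym prime_coprime.
by rewrite -(subnKC le) Ea expnD (mulnC a) expnM -[in RHS]modnMmr -[in RHS]modnXm kp modnXm exp1n modnMmr muln1.
Qed.

Lemma eq_Fp_nat m n : (m%:R == n%:R :> 'F_p) = (m == n %[mod p]).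
Proof. by rewrite -(inj_eq val_inj) /= !val_Fp_nat. Qed.

(** In the Newton expansion of [k ^ r] at the point [k], the coefficient of [surj k r] is 1; the
    lower terms agree by induction, the powers by Fermat's theorem. *)
Lemma surj_period k r r' : (0 < r)%N -> (0 < r')%N ->
  r = r' %[mod p.-1] -> (surj k r)%:R = (surj k r')%:R :> 'F_p.
Proof.
move=> r_gt0 r'_gt0 E; elim/ltn_ind: k => k IH.
pose N := (k.+1 + maxn r r').+1; have ltk : (k < N)%N by rewrite /N; lia.
have split s : (s < N)%N -> (k ^ s)%:R =
    (surj k s)%:R + \sum_(i < N | i != Ordinal ltk) (surj i s)%:R * ('C(k, i))%:R :> 'F_p.
  move=> lts; rewrite -(surj_newton k lts) (bigD1 (Ordinal ltk)) //= binn muln1 natrD natr_sum.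
  by congr (_ + _); apply: eq_bigr => i _; rewrite natrM.
have : (k ^ r)%:R = (k ^ r')%:R :> 'F_p.
  by apply/eqP; rewrite eq_Fp_nat; apply/eqP/expn_modn_period.
rewrite !split; try by rewrite /N; lia.
set S := \sum_(i < N | _) _; set S' := \sum_(i < N | _) _.
suff -> : S = S' by apply: addIr.
apply: eq_bigr => i neq; have [lti|] := ltnP i k; first by rewrite IH.
rewrite leq_eqVlt => /orP[/eqP Ei|lti]; last by rewrite bin_small ?mulr0.
by case/eqP: neq; apply: val_inj.
Qed.

(** By periodicity [r] may be taken between 1 and [p - 1], too small for a surjection onto [k >= p]
    points. *)
Lemma surj_ge k r : (0 < r)%N -> (p <= k)%N -> (surj k r)%:R = 0 :> 'F_p.
Proof.
move=> r_gt0 lek; have p1 : (0 < p.-1)%N by have := prime_gt1 p_pr; lia.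
rewrite (@surj_period _ _ ((r.-1 %% p.-1).+1)) //; last first.
  by rewrite -addn1 modnDml addn1 prednK.
by rewrite surj_small //; have := ltn_pmod r.-1 p1; have := prime_gt1 p_pr; lia.
Qed.

Lemma runpsi_eq1 r : (0 < r)%N -> r = 1 %[mod p.-1] -> runpsi 'F_p r = 1.
Proof.
move=> r_gt0 E; apply/polyP=> k; rewrite coef_runpsi coef1 (@surj_period _ _ 1) //=.
by rewrite big_ord1 /= bin0 mul1n; case: k => //= k; rewrite big_ord0.
Qed.

Lemma gold_monic b rs : {in rs, forall r, runpsi 'F_p r = 1} ->
  gold 'F_p b rs \is monic /\ size (gold 'F_p b rs) = (size rs).+1.
Proof.
elim: rs b => [|r rs IH] b H /=; first by rewrite monic1 size_poly1.
have [mon sz] : gold 'F_p (~~ b) rs \is monic /\ size (gold 'F_p (~~ b) rs) = (size rs).+1.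
  by apply: IH => s rss; apply: H; rewrite inE rss orbT.
rewrite H ?mem_head // mulr1 -polyC_natr [_ + 'X]addrC; split.
  by rewrite monicMr // monicXaddC.
by rewrite size_Mmonic ?monic_neq0 ?monicXaddC // size_XaddC sz.
Qed.

(** Of the [2q] runs, those of [A] are all followed by another run and give [1 + 'X]; those of [B]
    give ['X]. *)
Lemma gold_alternating q x rs : {in rs, forall r, runpsi 'F_p r = 1} ->
  (size rs).+1 = q.*2 ->
  gold 'F_p true (x :: rs) = ('X * (1 + 'X)) ^+ q * runpsi 'F_p x.
Proof.
move=> H Eq; rewrite /= mulrAC; congr (_ * _).
elim: q rs H Eq => [|q IH] rs H Eq; first by rewrite double0 in Eq.
case: rs H Eq => [|r rs] H /=; first by rewrite doubleS.
rewrite doubleS => -[Eq]; rewrite H ?mem_head //; case: rs H Eq => [|s rs] H /= Eq.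
  have -> : q = 0%N by move: Eq; clear; lia.
  by rewrite expr1 /=; ring.
rewrite (H s) ?inE ?eqxx ?orbT // !mulr1.
rewrite exprS -(IH rs) //; first by rewrite /=; ring.
by move=> t ts; apply: H; rewrite !inE ts !orbT.
Qed.

End ModP.

(** * The lower bound *)

Section Lower.
Variable p : nat.
Hypothesis p_pr : prime p.

Lemma logn_prod_fact rs :
  (p.-1 * logn p (\prod_(r <- rs) r`!) + \sum_(r <- rs) digit_sum p r = sumn rs)%N.
Proof.
elim: rs => [|r rs IH]; first by rewrite !big_nil logn1 muln0.
rewrite !big_cons lognM ?fact_gt0 ?prodn_gt0 //=; last by move=> i; apply: fact_gt0.
by have := legendre p_pr r; rewrite mulnDr; lia.
Qed.

Lemma denom_bch_ge L b rs : all (leq 1) rs ->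
  (\sum_(r <- rs) digit_sum p r + p <= p ^ L.+1)%N ->
  (gold 'F_p b rs)`_(p ^ L) != 0 ->
  (forall c, (1 < c)%N -> (gold 'F_p b rs)`_(c * p ^ L) = 0) ->
  (logn p (\prod_(r <- rs) r`!) + L <= logn p (denom (bch (altw b rs))))%N.
Proof.
move=> rs_gt0; set s := (\sum_(r <- rs) _)%N; set D := (\prod_(r <- rs) r`!)%N => les Q1 Q0.
have p_gt1 := prime_gt1 p_pr; have p_gt0 := prime_gt0 p_pr.
have D_gt0 : (0 < D)%N by rewrite prodn_gt0 // => i; apply: fact_gt0.
set w := altw b rs; set v := logn p D; set n := size w.
pose Z : {poly int} := gold int b rs.
have Zc k : D%:R * ncpow bchU k w = (Z`_k)%:~R.
  by rewrite goldberg // -(map_gold (intr : {rmorphism int -> rat})) coef_map.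
have ZF k : (gold 'F_p b rs)`_k = (Z`_k)%:~R.
  by rewrite -(map_gold (intr : {rmorphism int -> 'F_p})) coef_map.
have lepL : (p ^ L <= n)%N.
  rewrite leqNgt; apply: contra Q1 => lt; rewrite ZF.
  suff -> : Z`_(p ^ L) = 0 by [].
  by apply: (@intr_inj rat); rewrite -Zc ncpow_low ?mulr0 //; apply: bch_const.
rewrite leqNgt; apply/negP => lt.
(* A denominator with fewer factors [p] than claimed would leave this p-integral although one [p] is
   removed from [D * p ^ L]. *)
pose X := (D * p ^ L)%:R / p%:R * bch w.
have pX : pint p X.
  have [D' pD' ED] := pfactor_coprime p_pr D_gt0.
  have -> : X = D'%:R * ((p ^ (v + L).-1)%:R * bch w).
    rewrite /X mulrA; congr (_ * _).
    have E : (D * p ^ L = D' * p ^ (v + L).-1 * p)%N.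
      by rewrite {1}ED -!mulnA -expnD -expnSr prednK //; move: lt; lia.
    by rewrite E !natrM mulfK // pnatr_eq0 -lt0n.
  apply: pintM => //; first exact: pint_nat.
  by rewrite -logn_denom_le //; move: lt; lia.
pose T k := (-1) ^+ k.+1 * ((D * p ^ L)%:R / (p * k)%:R * ncpow bchU k w).
have XE : X = \sum_(1 <= k < n.+1) T k.
  rewrite /X bchE // mulr_sumr; apply: eq_bigr => k _.
  by rewrite /T [(p * k)%:R]natrM invfM; ring.
have other k : (0 < k <= n)%N -> k != (p ^ L)%N -> pint p (T k).
  move=> /andP[k_gt0 lek] neq; rewrite /T pint_sign.
  have lpk : logn p (p * k) = (logn p k).+1 by rewrite lognM // logn_prime // eqxx.
  have split : (D * p ^ L)%:R / (p * k)%:R * ncpow bchU k w =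
      (Z`_k)%:~R * ((p ^ L)%:R / (p * k)%:R) by rewrite -Zc [(D * _)%:R]natrM; ring.
  have [ltL|ltL|EL] := ltngtP (logn p k) L.
  - rewrite split; apply: pintM => //; first exact: pint_int.
    by apply: pint_divn; rewrite // lpk pfactorK.
  (* Here [L < v(k)], and an integer numerator is not enough. The low-order estimate is, because
     [s + p <= p ^ L.+1] also pays for the extra division by [p]. *)
  - have := low_order_pow p_pr k w; rewrite lek -/n; set e := ((n - k) %/ p.-1)%N => pc.
    have p_e0 : (p ^ e)%:R != 0 :> rat by rewrite pnatr_eq0 -lt0n expn_gt0 p_gt0.
    have -> : (D * p ^ L)%:R / (p * k)%:R * ncpow bchU k w =
        (D * p ^ L)%:R / (p * k * p ^ e)%:R * ((p ^ e)%:R * ncpow bchU k w).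
      by rewrite [(_ * p ^ e)%:R]natrM invfM [in RHS]mulrA [in RHS]mulrA mulfVK.
    apply: pintM => //; apply: pint_divn => //.
    rewrite !lognM ?muln_gt0 ?expn_gt0 ?p_gt0 // !pfactorK // logn_prime // eqxx -/v.
    have pk : (p ^ logn p k <= k)%N by rewrite dvdn_leq // pfactor_dvdnn.
    have := expn_sub_ge p_pr L.+1 (logn p k - L.+1); rewrite subnKC //.
    have : (p ^ L.+1 <= p ^ logn p k)%N by rewrite leq_exp2l.
    have := logn_prod_fact rs; rewrite -/D -/v -/s -(size_altw b) -/w -/n.
    have := leq_divM (n - k) p.-1; rewrite -/e.
    move: (p ^ _.+1)%N (p ^ logn p k)%N les pk => x y les pk qe nE le1 le2.
    rewrite leqNgt; apply/negP => lt'.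
    have : (p.-1 * v <= p.-1 * (e + (logn p k - L.+1) + 1))%N.
      by rewrite leq_mul2l; apply/orP; right; lia.
    by rewrite !mulnDr (mulnC _ e); lia.
  (* Now [v(k) = L], so [k] is a proper multiple of [p ^ L], and the vanishing modulo [p] supplies
     the missing factor [p]. *)
  have /dvdnP[c Ec] : (p ^ L %| k)%N by rewrite -EL pfactor_dvdnn.
  have c_gt1 : (1 < c)%N.
    by case: c Ec => [|[|c]] // Ec; [rewrite Ec in k_gt0 | rewrite Ec mul1n eqxx in neq].
  have /dvdzP[z Ez] : (p %| Z`_k)%Z.
    by rewrite (dvdz_pcharf (pchar_Fp p_pr)) -ZF Ec Q0.
  rewrite split Ez rmorphM /= -mulrA; apply: pintM => //; first exact: pint_int.
  rewrite mulrA -natrM; apply: pint_divn => //.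
  by rewrite lpk EL -expnS pfactorK.
have pL_gt0 : (0 < p ^ L)%N by rewrite expn_gt0 p_gt0.
have : pint p (T (p ^ L)%N).
  rewrite (_ : T _ = X - \sum_(1 <= k < n.+1 | k != (p ^ L)%N) T k); last first.
    by rewrite XE (bigD1_seq (p ^ L)%N) ?iota_uniq ?addrK // mem_index_iota pL_gt0 ltnS.
  apply: pintD => //; rewrite pintN big_nat_cond; apply: pint_sum => // k.
  by rewrite ltnS => /andP[]; apply: other.
rewrite /T pint_sign.
have -> : (D * p ^ L)%:R / (p * p ^ L)%:R * ncpow bchU (p ^ L) w = (Z`_(p ^ L))%:~R / p%:R.
  rewrite -Zc !natrM.
  have f1 : p%:R != 0 :> rat by rewrite pnatr_eq0 -lt0n.
  have f2 : (p ^ L)%:R != 0 :> rat by rewrite pnatr_eq0 -lt0n.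
  by field; rewrite f1 f2.
case/pintP => d [m [pd E]].
have : (p %| Z`_(p ^ L) * d%:Z)%Z.
  apply/dvdzP; exists m; apply: (@intr_inj rat); rewrite !rmorphM /= -E.
  by field; rewrite pnatr_eq0 -lt0n.
rewrite Gauss_dvdzl; last by rewrite coprimezE /= prime_coprime.
by rewrite (dvdz_pcharf (pchar_Fp p_pr)) -ZF (negPf Q1).
Qed.

End Lower.

(** * Words attaining the lower bound *)

Section Words.
Variable p : nat.
Hypothesis p_pr : prime p.

Lemma gold_coef_monic b rs L : {in rs, forall r, runpsi 'F_p r = 1} -> size rs = (p ^ L)%N ->
  (gold 'F_p b rs)`_(p ^ L) != 0 /\
  forall c, (1 < c)%N -> (gold 'F_p b rs)`_(c * p ^ L) = 0.
Proof.
move=> H sz; have [mon szg] := gold_monic b H; rewrite sz in szg; split=> [|c c_gt1].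
  by move/monicP: mon; rewrite lead_coefE szg /= => ->; rewrite oner_eq0.
by rewrite nth_default // szg ltn_Pmull // expn_gt0 prime_gt0.
Qed.

Lemma coef_1DX_exp (R : comNzRingType) q k : ((1 + 'X) ^+ q : {poly R})`_k = 'C(q, k)%:R.
Proof.
rewrite addrC exprD1n coef_sum; have [lek|ltk] := leqP k q.
  rewrite (bigD1 (Ordinal (lek : k < q.+1)%N)) //= coefMn coefXn eqxx big1 ?addr0 // => i.
  by rewrite coefMn coefXn eq_sym -val_eqE /= => /negPf->; rewrite mul0rn.
rewrite bin_small // big1 // => i _; rewrite coefMn coefXn.
by case: eqP => [E|]; [have := ltn_ord i; lia | rewrite mul0rn].
Qed.

(** With [2q = p ^ L + 1], the coefficient is that of degree [q - 1] in [(1 + 'X) ^+ q * runpsi x].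
    Modulo [p] the degree of [runpsi x] is at most [p - 2], which excludes the higher multiples of
    [p ^ L]. *)
Lemma gold_coef_alternating x rs L : odd p -> (0 < L)%N -> (0 < x)%N ->
  {in rs, forall r, runpsi 'F_p r = 1} -> size rs = (p ^ L)%N ->
  (gold 'F_p true (x :: rs))`_(p ^ L) != 0 /\
  forall c, (1 < c)%N -> (gold 'F_p true (x :: rs))`_(c * p ^ L) = 0.
Proof.
move=> p_odd L_gt0 x_gt0 H sz; pose q := (p ^ L).+1./2.
have p_gt1 := prime_gt1 p_pr.
have lep : (p <= p ^ L)%N by rewrite -{1}(expn1 p) leq_exp2l.
have Eq : (p ^ L).+1 = q.*2 by rewrite /q -[LHS]odd_double_half /= oddX p_odd orbT.
rewrite (@gold_alternating _ q) ?sz // exprMn -mulrA.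
have coefQ k : (q <= k)%N -> ('X^q * ((1 + 'X) ^+ q * runpsi 'F_p x))`_k =
    \sum_(j < (k - q).+1) 'C(q, k - q - j)%:R * (surj j.+1 x)%:R.
  move=> leq; rewrite coefXnM ltnNge leq /= coefMr; apply: eq_bigr => j _.
  by rewrite coef_1DX_exp coef_runpsi.
split=> [|c c_gt1].
  rewrite coefQ; last by lia.
  have Eq1 : (p ^ L - q = q.-1)%N by lia.
  have q_gt0 : (0 < q)%N by lia.
  rewrite Eq1 prednK //.
  (* By the symmetry of binomials this is the Newton expansion of [q ^ x], whose term at 0 vanishes
     since [0 < x]. *)
  have -> : \sum_(j < q) 'C(q, q.-1 - j)%:R * (surj j.+1 x)%:R = (q ^ x)%:R :> 'F_p.
    have ltx : (x < (q + x).+1)%N by lia.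
    rewrite -(surj_newton q ltx) big_ord_recl bin0 /= (gtn_eqF x_gt0) add0n big_split_ord /=.
    rewrite [X in (_ + X)%N]big1 => [|i _]; last by rewrite bin_small ?muln0 // /bump /=; lia.
    rewrite addn0 natr_sum; apply: eq_bigr => j _; have ltj := ltn_ord j.
    rewrite natrM mulrC; congr (_ * _%:R); rewrite -[in RHS]bin_sub; last by rewrite /bump /=; lia.
    by congr 'C(_, _); rewrite /bump /=; lia.
  rewrite -(dvdn_pcharf (pchar_Fp p_pr)) Euclid_dvdX // x_gt0 andbT.
  apply/negP => pq; have : (p %| (p ^ L).+1)%N by rewrite Eq -muln2 dvdn_mulr.
  by rewrite -addn1 dvdn_addr ?dvdn_exp // dvdn1 => /eqP p1; rewrite p1 in p_gt1.
have le2 : ((p ^ L).*2 <= c * p ^ L)%N by rewrite -mul2n leq_mul2r c_gt1 orbT.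
rewrite coefQ; last by lia.
apply: big1 => j _; have [lej|ltj] := leqP p j.+1; first by rewrite surj_ge // mulr0.
by rewrite bin_small ?mul0r //; lia.
Qed.

(** The disjunction serves to compute the digit sum of the merged run: either the whole sum has no
    carry, or fewer than [p] powers get merged. *)
Lemma powsum_long n : (p <= n)%N -> exists E L,
  [/\ powsum p E = n, (0 < L)%N, (p ^ L <= size E)%N /\ (size E + p <= p ^ L.+1)%N,
      digit_sum p n = size E \/ (size E < p ^ L + p.-1)%N
    & (p.-1 * (logn p n`! + l_ n p) + size E = n + p.-1 * L)%N].
Proof.
move=> len; have p_gt1 := prime_gt1 p_pr; have n_gt0 : (0 < n)%N by lia.
have s_gt0 := digit_sum_gt0 p_pr n_gt0.
have [E En sE] := powsum_exists p_pr n; have L := legendre p_pr n.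
have := trunc_logP p_gt1 s_gt0; have := trunc_log_ltn (digit_sum p n) p_gt1.
rewrite -/(l_ n p); set l := l_ n p => lt ge.
have [le|gt] := leqP (digit_sum p n + p) (p ^ l.+1).
  exists E, l; rewrite sE En; split; rewrite ?mulnDr; [by []| |by []|by left|by lia].
  by rewrite lt0n; apply/eqP => l0; move: le; rewrite l0 expn1; lia.
(* If all exponents were 0, then [n] would equal its digit sum and [n!] would be prime to [p],
   against [p <= n]. *)
have [e eE e_gt0] : exists2 e, e \in E & (0 < e)%N.
  apply/hasP; apply: contraT => /hasPn E0.
  have vn : (0 < logn p n`!)%N.
    by rewrite -pfactor_dvdn ?fact_gt0 // expn1 dvdn_fact // prime_gt0.
  have ns : n = digit_sum p n.
    rewrite -{1}En -sE /powsum -sum1_size big_seq [RHS]big_seq; apply: eq_bigr => e /E0.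
    by rewrite -eqn0Ngt => /eqP->.
  have : (0 < p.-1 * logn p n`!)%N by rewrite muln_gt0 vn andbT; lia.
  by lia.
(* One [p ^ e] is split into [p] equal parts, which adds [p - 1] to the size. *)
exists (nseq p e.-1 ++ rem e E), l.+1.
have szE : (size (nseq p e.-1 ++ rem e E) = digit_sum p n + p.-1)%N.
  by rewrite size_cat size_nseq size_rem // sE; lia.
have lel : (p <= p ^ l.+1)%N by rewrite -{1}(expn1 p) leq_exp2l.
have lel2 : (p ^ l.+1 + p.-1 * p <= p ^ l.+2)%N.
  rewrite [(p ^ l.+2)%N]expnS -[X in (_ <= X * _)%N](prednK (prime_gt0 p_pr)) mulSn.
  by rewrite leq_add2l leq_mul2l lel orbT.
rewrite szE; split=> //.
- rewrite powsum_cat -En /powsum (perm_big _ (perm_to_rem eE)) big_cons; congr (_ + _)%N.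
  by rewrite big_nseq iter_addn_0 -expnSr prednK.
- split; first by lia.
  have : (p.-1 * 2 <= p.-1 * p)%N by rewrite leq_mul2l p_gt1 orbT.
  by lia.
- by right; lia.
by rewrite mulnDr mulnS; lia.
Qed.

Lemma runpsi_exp e : runpsi 'F_p (p ^ e) = 1.
Proof.
apply: (runpsi_eq1 p_pr); first by rewrite expn_gt0 prime_gt0.
by have := powsum_modn p_pr [:: e]; rewrite /powsum big_seq1.
Qed.

(** By Legendre's formula for the runs, the last equation is [v(D) + L = v(n!) + l(n,p)] multiplied
    by [p - 1]. *)
Lemma runs_exist n : (p <= n)%N -> exists b rs L,
  [/\ all (leq 1) rs, sumn rs = n,
      (\sum_(r <- rs) digit_sum p r + p <= p ^ L.+1)%N,
      (gold 'F_p b rs)`_(p ^ L) != 0 /\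
      forall c, (1 < c)%N -> (gold 'F_p b rs)`_(c * p ^ L) = 0
    & (p.-1 * (logn p n`! + l_ n p) + \sum_(r <- rs) digit_sum p r = n + p.-1 * L)%N].
Proof.
move=> len; have p_gt1 := prime_gt1 p_pr.
have [E [L [En L_gt0 [leL geL] ok eqL]]] := powsum_long len.
(* With the merged run there are [p ^ L + 1] runs for odd [p], an even number as [gold_alternating]
   requires, and [p ^ L] runs for [p = 2], as [gold_coef_monic] requires. *)
pose m := if odd p then (p ^ L)%N else (p ^ L).-1.
have lep : (p <= p ^ L)%N by rewrite -{1}(expn1 p) leq_exp2l.
pose E1 := take (size E - m) E; pose E2 := drop (size E - m) E.
have lem : (m <= p ^ L)%N by rewrite /m; case: odd => //; lia.
have sz1 : size E1 = (size E - m)%N by rewrite size_takel ?leq_subr.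
have sz2 : size E2 = m by rewrite size_drop subKn //; lia.
pose x := powsum p E1; pose rs := [seq (p ^ e)%N | e <- E2].
have Ex : (x + sumn rs = n)%N.
  by rewrite sumnE big_map -[(\sum_(_ <- _) _)%N]/(powsum p E2) -powsum_cat cat_take_drop.
have rs_gt0 : all (leq 1) rs.
  by apply/allP=> r /mapP[e _ ->]; rewrite expn_gt0 prime_gt0.
have dx : digit_sum p x = size E1.
  apply: (digit_sum_powsum_eq p_pr (F := E2)); rewrite cat_take_drop En.
  case: ok => [|lt]; [by left | right; rewrite sz1 /m].
  case: ifPn => [_|podd]; first by lia.
  by have [p2|] := even_prime p_pr; [lia | rewrite (negPf podd)].
have drs : (\sum_(r <- rs) digit_sum p r = m)%N.
  by rewrite big_map; under eq_bigr do rewrite digit_sum_exp //; rewrite sum1_size sz2.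
have rs1 : {in rs, forall r, runpsi 'F_p r = 1} by move=> r /mapP[e _ ->]; apply: runpsi_exp.
have szrs : size rs = m by rewrite size_map.
have sumE : (digit_sum p x + m = size E)%N by rewrite dx sz1 subnK //; lia.
have cons_case b : (0 < x)%N -> (gold 'F_p b (x :: rs))`_(p ^ L) != 0 /\
      (forall c, (1 < c)%N -> (gold 'F_p b (x :: rs))`_(c * p ^ L) = 0) ->
  exists b rs L,
  [/\ all (leq 1) rs, sumn rs = n,
      (\sum_(r <- rs) digit_sum p r + p <= p ^ L.+1)%N,
      (gold 'F_p b rs)`_(p ^ L) != 0 /\
      forall c, (1 < c)%N -> (gold 'F_p b rs)`_(c * p ^ L) = 0
    & (p.-1 * (logn p n`! + l_ n p) + \sum_(r <- rs) digit_sum p r = n + p.-1 * L)%N].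
  move=> x_gt0 G; exists b, (x :: rs), L; split=> //; first by rewrite /= x_gt0.
    by rewrite big_cons drs sumE.
  by rewrite big_cons drs sumE.
(* Without surplus, [size E = m] forces [m = p ^ L], and the monic case applies. *)
have [x0|x_gt0] := posnP x.
  have szE : size E = m by rewrite -sumE x0 digit_sum0.
  exists true, rs, L; split=> //; rewrite ?drs -?szE //; first by rewrite -Ex x0.
  by apply: gold_coef_monic; rewrite // szrs; lia.
have [p2|podd] := even_prime p_pr; last first.
  apply: (cons_case true x_gt0); apply: gold_coef_alternating => //.
  by rewrite szrs /m podd.
(* For [p = 2] the modulus [p - 1] is 1, so the merged run also has [runpsi] equal to 1. *)
apply: (cons_case true x_gt0); apply: gold_coef_monic => [r|].
  rewrite inE => /orP[/eqP->|/rs1//]; apply: (runpsi_eq1 p_pr) => //.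
  by rewrite p2 !modn1.
by rewrite /= szrs /m p2 /= prednK // expn_gt0.
Qed.

End Words.

(** * Comparing valuations prime by prime *)

Lemma denom_bch_ge_exists p n : prime p -> (0 < n)%N -> exists w : n.-tuple bool,
  (logn p n`! + l_ n p <= logn p (denom (bch w)))%N.
Proof.
move=> p_pr n_gt0; have p_gt1 := prime_gt1 p_pr; have [len|ltn] := leqP p n; last first.
  (* For [n < p] the left-hand side is 0, so any word serves. *)
  exists [tuple of nseq n true].
  rewrite /l_ (digit_sum_lt p_pr ltn).
  have -> : trunc_log p n = 0%N by apply/eqP; rewrite trunc_log_eq0; apply/orP; right; lia.
  rewrite addn0; have := legendre p_pr n; rewrite (digit_sum_lt p_pr ltn).
  have p1 : (0 < p.-1)%N by lia.
  by move/eqP; rewrite -{3}[n]add0n eqn_add2r muln_eq0 eqn0Ngt p1 => /eqP->.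
have [b [rs [L [rs_gt0 sum_rs les [Q1 Q0] E]]]] := runs_exist p_pr len.
have szw : size (altw b rs) == n by rewrite size_altw sum_rs.
exists (Tuple szw); apply: leq_trans (denom_bch_ge p_pr rs_gt0 les Q1 Q0).
have := logn_prod_fact p_pr rs; rewrite sum_rs => En.
have p1 : (0 < p.-1)%N by lia.
by rewrite -(leq_pmul2l p1) [(_ * (_ + L))%N]mulnDr; lia.
Qed.

(** The primes [p >= n], left out of the product [d_ n], would contribute nothing; for [p = n] the
    digit sum is 1. *)
Lemma l_eq0 n p : prime p -> (0 < n)%N -> (n <= p)%N -> l_ n p = 0%N.
Proof.
move=> p_pr n_gt0 len; have p_gt1 := prime_gt1 p_pr; apply/eqP.
rewrite /l_ trunc_log_eq0; apply/orP; right.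
have [->|neq] := eqVneq n p.
  by have := digit_sum_exp p_pr 1; rewrite expn1 => ->; lia.
by rewrite digit_sum_lt //; lia.
Qed.

Lemma logn_d n p : prime p -> (0 < n)%N -> logn p (d_ n) = l_ n p.
Proof.
move=> p_pr n_gt0.
have -> : logn p (d_ n) = (\sum_(0 <= q < n | prime q) (if q == p then l_ n q else 0))%N.
  rewrite /d_; elim: index_iota => [|q s IH]; first by rewrite !big_nil logn1.
  rewrite !big_cons; case: ifP => // q_pr.
  rewrite lognM ?prodn_cond_gt0 ?expn_gt0 ?(prime_gt0 q_pr) // => [|r r_pr]; last first.
    by rewrite expn_gt0 prime_gt0.
  rewrite IH lognX logn_prime // eq_sym; congr (_ + _)%N.
  by case: eqP; rewrite ?muln1 ?muln0.
have [len|ltn] := leqP n p.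
  rewrite l_eq0 // big_nat_cond big1 // => q /andP[/andP[_ ltq] _].
  by case: eqP ltq => // ->; rewrite ltnNge len.
rewrite big_mkcond (bigD1_seq p) ?iota_uniq ?mem_index_iota //= p_pr eqxx big1 ?addn0 //.
by move=> q /negPf->; rewrite if_same.
Qed.

Lemma d_gt0 n : (0 < d_ n)%N.
Proof.
rewrite /d_ big_seq_cond; apply: prodn_cond_gt0 => q /andP[_ q_pr].
by rewrite expn_gt0 prime_gt0.
Qed.

Lemma dvdn_logn m n : (0 < m)%N -> (0 < n)%N ->
  (forall p, prime p -> (logn p m <= logn p n)%N) -> (m %| n)%N.
Proof.
move=> m_gt0 n_gt0 H; apply/dvdn_partP => // p; rewrite mem_primes => /andP[p_pr _].
by rewrite p_part pfactor_dvdn // H.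
Qed.

Theorem theorem1 (n : nat) (n_gt0 : (0 < n)%N) :
  \big[lcmn/1%N]_(w : n.-tuple bool) denom (coeff w bch) = (n`! * d_ n)%N.
Proof.
have N_gt0 : (0 < n`! * d_ n)%N by rewrite muln_gt0 fact_gt0 d_gt0.
have lognN p : prime p -> logn p (n`! * d_ n) = (logn p n`! + l_ n p)%N.
  by move=> p_pr; rewrite lognM ?fact_gt0 ?d_gt0 // logn_d.
have upper : (\big[lcmn/1%N]_(w : n.-tuple bool) denom (coeff w bch) %| n`! * d_ n)%N.
  apply/dvdn_biglcmP => w _; apply: dvdn_logn => //; first by rewrite absz_gt0 denq_neq0.
  move=> p p_pr; rewrite lognN //.
  by have := @denom_bch_le p p_pr w; rewrite size_tuple; apply.
apply/eqP; rewrite eqn_dvd upper; apply: dvdn_logn => //; first exact: dvdn_gt0 upper.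
move=> p p_pr; have [w le] := denom_bch_ge_exists p_pr n_gt0.
rewrite lognN //; apply: leq_trans le _; apply: dvdn_leq_log; first exact: dvdn_gt0 upper.
exact: (biglcmn_sup w).
Qed.
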